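(* Let $n\in\mathbb{N}$, $n\ge 1$, let $C_0,C_1\in\mathbb{R}^n$, $r_0,r_1>0$, and let $\mathcal{L}=\mathcal{U}\cap\bar{\mathcal{B}}(C_0,r_0)\cap\bar{\mathcal{B}}(C_1,r_1)$, with $$\min_{x\in\mathcal{U}}\|x-C_i\|\ge 1\qquad\text{for all } i\in\{0,1\}.$$ Then for every $K>0$, $$|\mathrm{vol}(\mathcal{L})-T(K)|\le\frac{n}{\sqrt{2n-1}\cdot K}\cdot\sum_{i=0}^{1}\sqrt{n}\cdot\left(\frac{\sqrt{n}}{2}+\left\|C_i-\tfrac12\cdot 1_{n\times1}\right\|\right).$$
   Context: $\mathcal{U}=\{x\in\mathbb{R}^n : 0\le x_i\le 1,\ i=1,\dots,n\}$ is the unit hypercube, $1_{n\times 1}\in\mathbb{R}^n$ is the all-ones vector, $\|\cdot\|$ is the Euclidean norm, $\bar{\mathcal{B}}(C,r)$ is the closed ball of center $C$ and radius $r$, and $\mathrm{vol}$ is $n$-dimensional Lebesgue measure. For $K>0$ and $t\in\mathbb{R}$ put $$H_K(t)=\frac12+\frac{1}{\sqrt{\pi}}\int_0^K t\,e^{-(ty)^2}\,dy .$$ For $i\in\{0,1\}$ let $\rho_i(x)=r_i^2-\|x-C_i\|^2$, and define $$T(K)=\int_{0}^{1}dx_1\cdots\int_0^1 dx_n\; H_K(\rho_0(x))\,H_K(\rho_1(x)).$$ *)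

(* Defs.v *)
From HB Require Import structures.
From mathcomp Require Import all_boot all_order all_algebra.
From mathcomp Require Import all_classical all_reals all_analysis.

Set Implicit Arguments.
Unset Strict Implicit.
Unset Printing Implicit Defensive.
Import Order.TTheory GRing.Theory Num.Theory.
Import numFieldNormedType.Exports.

Local Open Scope classical_set_scope.
Local Open Scope ring_scope.

Section lebesgue_tuple.
Variable R : realType.
Local Notation TR := (measurableTypeR R).

Definition cons_pair n (p : TR * n.-tuple TR) : n.+1.-tuple TR :=
  [tuple of p.1 :: p.2].

Lemma measurable_cons_pair n :
  measurable_fun [set: TR * n.-tuple TR] (@cons_pair n).
Proof. exact: measurable_cons. Qed.

Section cons_measure.
Variables (n : nat) (mu : {sigma_finite_measure set (n.-tuple TR) -> \bar R}).

Definition cons_measure : set (n.+1.-tuple TR) -> \bar R :=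
  pushforward (@lebesgue_measure R \x mu)%E (@cons_pair n).

HB.instance Definition _ := Measure.copy cons_measure
  (measure_function_pushforward__canonical__measure_function_Measure
     _ (@measurable_cons_pair n)).

Lemma cons_measureX (A : set TR) (B : set (n.-tuple TR)) :
  measurable A -> measurable B ->
  cons_measure [set t | A (thead t) /\ B [tuple of behead t]] =
  (lebesgue_measure A * mu B)%E.
Proof.
move=> mA mB; rewrite -product_measure1E// /cons_measure /pushforward.
congr (_ _); apply/seteqP; split=> -[x t] /=; rewrite theadE;
  by have -> : [tuple of behead [tuple of x :: t]] = t by exact: val_inj.
Qed.

Let cons_measure_sigma_finite : sigma_finite setT cons_measure.
Proof.
have /sigma_finiteP[F [TF ndF Foo]] := sigma_finiteT (@lebesgue_measure R).
have /sigma_finiteP[G [TG ndG Goo]] := sigma_finiteT mu.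
exists (fun k => [set t | F k (thead t) /\ G k [tuple of behead t]]).
  apply/seteqP; split=> // t _.
  have [i _ Fi] : (\bigcup_i F i) (thead t) by rewrite -TF.
  have [j _ Gj] : (\bigcup_i G i) [tuple of behead t] by rewrite -TG.
  exists (maxn i j) => //; split.
  - by move: Fi; exact/subsetPset/ndF/leq_maxl.
  - by move: Gj; exact/subsetPset/ndG/leq_maxr.
move=> k; have [mF Fk] := Foo k; have [mG Gk] := Goo k; split.
  apply: measurableI.
  - rewrite -[X in measurable X]setTI; exact: measurable_tnth.
  - rewrite -[X in measurable X]setTI; exact: measurable_behead.
by rewrite cons_measureX// lte_mul_pinfty// ge0_fin_numE.
Qed.

HB.instance Definition _ := Measure_isSigmaFinite.Build _ _ _ cons_measure
  cons_measure_sigma_finite.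
End cons_measure.

(* n-dimensional Lebesgue measure, as the n-fold product of the Lebesgue measure
   on the Borel sets of the line *)
Fixpoint lebesgue_tuple n : {sigma_finite_measure set (n.-tuple TR) -> \bar R} :=
  match n with
  | 0 => \d_[tuple]
  | n'.+1 => cons_measure (lebesgue_tuple n')
  end.

Lemma measurable_rectangle n (A : 'I_n -> set TR) :
  (forall i, measurable (A i)) ->
  measurable [set t : n.-tuple TR | forall i, A i (tnth t i)].
Proof.
move=> mA.
rewrite (_ : [set t | _] =
    \bigcap_(i in [set: 'I_n]) ((fun t : n.-tuple TR => tnth t i) @^-1` A i)).
  apply: fin_bigcap_measurable => // i _.
  by rewrite -[X in measurable X]setTI; exact: measurable_tnth.
by apply/seteqP; split=> t /= h i; [move=> _|]; exact: h.
Qed.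

Lemma lebesgue_tuple_rectangle n (A : 'I_n -> set TR) :
  (forall i, measurable (A i)) ->
  lebesgue_tuple n [set t | forall i, A i (tnth t i)] =
  (\prod_(i < n) lebesgue_measure (A i))%E.
Proof.
elim: n A => [|n ih] A mA.
  by rewrite big_ord0 /= diracE mem_set// => -[].
rewrite big_ord_recl -(ih (A \o lift ord0))//; last by move=> i; exact: mA.
rewrite -cons_measureX//; last by apply: measurable_rectangle => i; exact: mA.
congr (cons_measure _ _); apply/seteqP; split=> t /=.
- move=> h; split; first exact: (h ord0).
  by move=> i; rewrite tnth_behead; have := h (lift ord0 i);
    rewrite (_ : inord i.+1 = lift ord0 i)//; apply/val_inj; rewrite /= inordK// ltnS.
- move=> [h0 h] i; case: (unliftP ord0 i) => [j ->|->]; last exact: h0.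
  by have := h j; rewrite tnth_behead (_ : inord j.+1 = lift ord0 j)//;
    apply/val_inj; rewrite /= inordK// ltnS.
Qed.

End lebesgue_tuple.

Section definitions.
Variable R : realType.
Implicit Types (n : nat) (K r t : R).

Definition row_of_tuple n (t : n.-tuple R) : 'rV[R]_n := \row_i tnth t i.

(* n-dimensional Lebesgue measure, transported to row vectors *)
Definition vol n (A : set 'rV[R]_n) : \bar R :=
  lebesgue_tuple R n (@row_of_tuple n @^-1` A).

Lemma vol_box n (a b : 'rV[R]_n) : (forall i, a 0 i <= b 0 i) ->
  vol [set x | forall i, a 0 i <= x 0 i <= b 0 i] =
  (\prod_(i < n) (b 0 i - a 0 i))%:E.
Proof.
move=> ab; rewrite /vol (_ : _ @^-1` _ = [set t : n.-tuple R |
    forall i, (`[a 0 i, b 0 i]%classic : set R) (tnth t i)]); last first.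
  by apply/seteqP; split=> t /= h i; have := h i; rewrite mxE in_itv.
apply: (etrans (@lebesgue_tuple_rectangle R n
  (fun i => `[a 0 i, b 0 i]%classic) _)) => //.
rewrite -prodEFin; apply: eq_bigr => i _.
rewrite lebesgue_measure_itv/= lte_fin; case: ltP => //.
by move=> ba; rewrite (@le_anti _ _ (a 0 i) (b 0 i)) ?ab// subrr.
Qed.

(* the library's norm on matrices is the sup norm *)
Definition enorm n (x : 'rV[R]_n) : R := Num.sqrt (\sum_(i < n) x 0 i ^+ 2).

Definition unit_cube n : set 'rV[R]_n := [set x | forall i, 0 <= x 0 i <= 1].

Definition closed_eball n (C : 'rV[R]_n) r : set 'rV[R]_n :=
  [set x | enorm (x - C) <= r].

Definition HK K t : R :=
  2^-1 + (Num.sqrt pi)^-1 *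
    \int[lebesgue_measure]_(y in `[0, K]) (t * expR (- (t * y) ^+ 2)).

Definition rho n (C : 'rV[R]_n) r (x : 'rV[R]_n) : R :=
  r ^+ 2 - enorm (x - C) ^+ 2.

(* the first coordinate is the outermost integration variable; 'rV[R]_0 has
   a single point *)
Fixpoint iterated_int n : ('rV[R]_n -> R) -> R :=
  match n with
  | 0 => fun f => f 0
  | n'.+1 => fun f => \int[lebesgue_measure]_(t in `[0, 1])
      iterated_int (fun x : 'rV[R]_n' => f (row_mx t%:M x))
  end.

Definition TK n (C : 'I_2 -> 'rV[R]_n) (r : 'I_2 -> R) K : R :=
  iterated_int (fun x => HK K (rho (C 0) (r 0) x) * HK K (rho (C 1) (r 1) x)).

Definition lens n (C : 'I_2 -> 'rV[R]_n) (r : 'I_2 -> R) : set 'rV[R]_n :=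
  @unit_cube n `&` closed_eball (C 0) (r 0) `&` closed_eball (C 1) (r 1).

End definitions.

Arguments unit_cube {R} n.

(* Main.v *)
Require Import Defs.
From mathcomp Require Import all_boot all_order all_algebra.
From mathcomp Require Import all_classical all_reals all_analysis.
From mathcomp Require Import measurable_realfun ring lra.

Import Order.TTheory GRing.Theory Num.Theory.
Import numFieldNormedType.Exports.

Local Open Scope classical_set_scope.
Local Open Scope ring_scope.

(** Write mu for the Lebesgue measure and D for the unit cube.  Both the volume
    of the lens and the iterated integral are integrals over D: of the product
    of the two steps [rho_i >= 0], and of the product of the two smoothed steps
    H_K(rho_i).  All factors lie in [0, 1], so the difference of the products
    is at most the sum over i of the differences of the factors, and it suffices
    to bound, for one ball, the integral over D of |[rho >= 0] - H_K(rho)|.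

    Pointwise this error is half a complementary error function, hence at most
    exp(-(K rho)^2)/2 (gauss_integral_tail, HK_step_error), hence at most the
    Lorentzian 1/(2 (1 + (K rho)^2)), whose primitive is an arctangent.

    The distance hypothesis gives a direction in which rho varies fast on the
    whole cube: comparing the center c with its nearest point of D, some
    coordinate c_j is at distance v >= 1/sqrt n from [0, 1] (far_coordinate).
    Along the j-th axis, rho is a - (t - c_j)^2, which is monotone on [0, 1]
    with slope at least 2v in absolute value, so |rho| >= 2v|t - t0| for some t0
    (parabola_linear_growth), and the line integral of the Lorentzian is at most
    pi/(4Kv) <= sqrt n/K (integral_lorentz_line).  Integrating along this axis
    first and using mu(D) = 1 (cube_integral_slice) gives the bound sqrt n/K for
    each ball.  This is smaller than the claimed constant because
    n >= sqrt(2n - 1) and the center of D is at distance at least 1 from c. *)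

(** * Tonelli on the unit cube *)

Section cube_tonelli.
Variable R : realType.
Local Notation TR := (measurableTypeR R).
Local Notation I01 := (`[0, 1]%classic : set TR).
Local Notation mu := (@lebesgue_measure R).

Definition tuple_cube n : set (n.-tuple TR) :=
  @row_of_tuple R n @^-1` unit_cube n.

Lemma tuple_cubeE n :
  tuple_cube n = [set t | forall i, (`[0, 1]%classic : set TR) (tnth t i)].
Proof.
by apply/seteqP; split => t /= h i; have := h i; rewrite /= mxE in_itv.
Qed.

Lemma measurable_tuple_cube n : measurable (tuple_cube n).
Proof.
rewrite tuple_cubeE.
by apply: (@measurable_rectangle R n (fun=> `[0, 1]%classic)).
Qed.

Lemma lebesgue_tuple_cube n : lebesgue_tuple R n (tuple_cube n) = 1%E.
Proof.
rewrite tuple_cubeE.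
apply: (etrans (@lebesgue_tuple_rectangle R n (fun=> `[0, 1]%classic) _)) => //.
by rewrite big1// => i _; rewrite lebesgue_measure_itv/= lte01 oppr0 adde0.
Qed.

Lemma row_of_tuple_cons n (t : R) (x : n.-tuple TR) :
  row_of_tuple (cons_pair (t, x)) = row_mx t%:M (row_of_tuple x).
Proof.
apply/rowP => i; rewrite !mxE.
case: splitP => j ij; rewrite !mxE.
  rewrite ord1 eqxx mulr1n.
  suff -> : i = ord0 by [].
  by apply: val_inj; rewrite /= ij ord1.
suff -> : i = lift ord0 j by rewrite tnthS.
by apply: val_inj; rewrite /= ij.
Qed.

Lemma tuple_cube_cons n (t : R) (x : n.-tuple TR) :
  tuple_cube n.+1 (cons_pair (t, x)) <-> `[0, 1]%classic t /\ tuple_cube n x.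
Proof.
rewrite !tuple_cubeE/=; split.
  move=> h; split=> [|i]; first exact: (h ord0).
  by have := h (lift ord0 i); rewrite tnthS.
by move=> [t01 h] i; case: (unliftP ord0 i) => [j|] ->; rewrite ?tnthS.
Qed.

(** lebesgue_tuple n.+1 is the image of the product measure under consing, so an
    integral over the cube can be computed with the first coordinate outermost
    or innermost. *)
Section tonelli.
Context n (f : n.+1.-tuple TR -> \bar R).
Hypothesis mf : measurable_fun [set: n.+1.-tuple TR] f.
Hypothesis f0 : forall x, (0 <= f x)%E.

(* Restricting to the cube before consing turns every integral below into one
   over the whole product space, where the product theorems apply. *)
Let g := fun p => (f \_ (tuple_cube n.+1)) (cons_pair p).

Let mg : measurable_fun [set: TR * n.-tuple TR] g.
Proof.
apply: (@measurableT_comp _ _ _ _ _ _ (f \_ (tuple_cube n.+1)));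
  last exact: measurable_cons_pair.
apply/(measurable_restrictT f (measurable_tuple_cube n.+1)).
exact: measurable_funTS.
Qed.

Let g0 p : (0 <= g p)%E.
Proof. by rewrite /g patchE; case: ifP. Qed.

Let gE t x : g (t, x) = if t \in I01 then
  if x \in tuple_cube n then f (cons_pair (t, x)) else 0%E else 0%E.
Proof.
rewrite /g patchE; case: ifPn => [/set_mem/tuple_cube_cons[t01 xc]|/negP h].
  by rewrite !mem_set.
case: ifPn => // /set_mem t01; case: ifPn => // /set_mem xc.
by exfalso; apply: h; apply/mem_set/tuple_cube_cons.
Qed.

Lemma measurable_cube_section : measurable_fun I01
  (fun t => \int[lebesgue_tuple R n]_(x in tuple_cube n) f (cons_pair (t, x)))%E.
Proof.
have := measurable_fun_fubini_tonelli_F (m2 := lebesgue_tuple R n) g mg g0.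
rewrite /fubini_F => /(measurable_funTS) => /(_ I01).
apply: eq_measurable_fun => t t01.
rewrite [RHS]integral_mkcond; apply: eq_integral => x _.
by rewrite gE t01.
Qed.

Lemma measurable_cube_section_swap : measurable_fun (tuple_cube n)
  (fun x => \int[mu]_(t in `[0%R, 1%R]) f (cons_pair (t, x)))%E.
Proof.
have := measurable_fun_fubini_tonelli_G (m1 := mu) g mg g0.
rewrite /fubini_G => /(measurable_funTS) => /(_ (tuple_cube n)).
apply: eq_measurable_fun => x xc.
rewrite [RHS]integral_mkcond; apply: eq_integral => t _.
by rewrite gE patchE xc.
Qed.

Let integral_prod :
  (\int[lebesgue_tuple R n.+1]_(x in tuple_cube n.+1) f x =
   \int[(mu \x lebesgue_tuple R n)%E]_p g p)%E.
Proof.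
rewrite integral_mkcond.
rewrite [LHS](ge0_integral_pushforward (@measurable_cons_pair R n)
  (mu \x lebesgue_tuple R n)%E)//; last 2 first.
- apply/(measurable_restrictT f (measurable_tuple_cube n.+1)).
  exact: measurable_funTS.
- by move=> y _; rewrite patchE; case: ifP.
Qed.

Lemma integral_lebesgue_tupleS :
  (\int[lebesgue_tuple R n.+1]_(x in tuple_cube n.+1) f x =
   \int[mu]_(t in `[0%R, 1%R])
     \int[lebesgue_tuple R n]_(x in tuple_cube n) f (cons_pair (t, x)))%E.
Proof.
rewrite integral_prod (fubini_tonelli1 g mg g0) /fubini_F [RHS]integral_mkcond.
apply: eq_integral => t _; rewrite [RHS]patchE; case: ifPn => t01.
  rewrite [RHS]integral_mkcond; apply: eq_integral => x _.
  by rewrite gE t01.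
by apply: integral0_eq => x _; rewrite gE (negbTE t01).
Qed.

Lemma integral_lebesgue_tupleS_swap :
  (\int[lebesgue_tuple R n.+1]_(x in tuple_cube n.+1) f x =
   \int[lebesgue_tuple R n]_(x in tuple_cube n)
     \int[mu]_(t in `[0%R, 1%R]) f (cons_pair (t, x)))%E.
Proof.
rewrite integral_prod (fubini_tonelli2 g mg g0) /fubini_G [RHS]integral_mkcond.
apply: eq_integral => x _; rewrite [RHS]patchE; case: ifPn => xc.
  rewrite [RHS]integral_mkcond; apply: eq_integral => t _.
  by rewrite gE xc.
apply: integral0_eq => t _; rewrite gE (negbTE xc).
by case: ifP.
Qed.

End tonelli.
End cube_tonelli.

Section cube_integration.
Variable R : realType.
Local Notation TR := (measurableTypeR R).
Local Notation I01 := (`[0, 1]%classic : set TR).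
Local Notation mu := (@lebesgue_measure R).

Lemma cube_integral_le n (f : n.-tuple TR -> \bar R) (B : R) :
  measurable_fun (tuple_cube R n) f -> (forall x, 0 <= f x)%E ->
  (forall x, tuple_cube R n x -> f x <= B%:E)%E ->
  (\int[lebesgue_tuple R n]_(x in tuple_cube R n) f x <= B%:E)%E.
Proof.
move=> mf f0 fB.
have mC := measurable_tuple_cube R n.
have -> : B%:E = (\int[lebesgue_tuple R n]_(x in tuple_cube R n) (cst B%:E) x)%E.
  rewrite integral_cst// -[LHS]mule1; congr (_ * _)%E.
  exact/esym/lebesgue_tuple_cube.
exact: ge0_le_integral.
Qed.

Lemma itv_integral_le (f : TR -> \bar R) (B : R) :
  measurable_fun I01 f -> (forall x, 0 <= f x)%E ->
  (forall x, I01 x -> f x <= B%:E)%E ->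
  (\int[mu]_(t in `[0%R, 1%R]) f t <= B%:E)%E.
Proof.
move=> mf f0 fB.
have -> : B%:E = (\int[mu]_(x in `[0%R, 1%R]) (cst B%:E) x)%E.
  rewrite integral_cst// -[LHS]mule1; congr (_ * _)%E; apply/esym.
  by apply: (etrans (lebesgue_measure_itv _)); rewrite /= lte01 oppr0 adde0.
exact: ge0_le_integral.
Qed.

Lemma measurable_cons_section n (t : TR) :
  measurable_fun [set: n.-tuple TR] (fun x => cons_pair (t, x)).
Proof. by apply: measurable_cons => //; exact: measurable_id. Qed.

(** The real-valued integral is a junk value on infinite integrals, so the
    induction carries a bound on f that keeps every partial integral finite. *)
Lemma iterated_intE n (f : 'rV[R]_n -> R) :
  measurable_fun [set: n.-tuple TR] (f \o @row_of_tuple R n) ->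
  (forall x, 0 <= f x <= 1) ->
  ((iterated_int f)%:E =
   \int[lebesgue_tuple R n]_(x in tuple_cube R n) (f (row_of_tuple x))%:E)%E.
Proof.
elim: n f => [|n ih] f mf f01.
  have m0 := measurable_tuple_cube R 0.
  rewrite [RHS]integral_dirac//.
    rewrite diracE mem_set ?mul1e; last by move=> -[].
    by rewrite /=; congr (f _)%:E; apply/rowP => -[].
  by apply: measurable_funTS; exact/measurable_EFinP.
have mfE : measurable_fun [set: n.+1.-tuple TR]
    (fun x => (f (row_of_tuple x))%:E) by exact/measurable_EFinP.
have f0 x : (0 <= (f (row_of_tuple x))%:E)%E.
  by rewrite lee_fin; case/andP: (f01 (row_of_tuple x)).
have intE : (\int[lebesgue_tuple R n.+1]_(x in tuple_cube R n.+1)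
      (f (row_of_tuple x))%:E = \int[mu]_(t in `[0%R, 1%R])
      (iterated_int (fun x : 'rV_n => f (row_mx t%:M x)))%:E)%E.
  rewrite integral_lebesgue_tupleS//; apply: eq_integral => t _.
  rewrite ih.
  - by apply: eq_integral => x _; rewrite row_of_tuple_cons.
  - rewrite (_ : _ \o _ = (f \o @row_of_tuple R n.+1) \o (fun x => cons_pair (t, x))).
      apply: measurableT_comp => //; exact: measurable_cons_section.
    by apply/funext => x /=; rewrite row_of_tuple_cons.
  - by move=> x; exact: f01.
have : (\int[lebesgue_tuple R n.+1]_(x in tuple_cube R n.+1)
      (f (row_of_tuple x))%:E)%E \is a fin_num.
  rewrite ge0_fin_numE; last by apply: integral_ge0 => x _.
  apply: (@le_lt_trans _ _ 1%:E); last exact: ltry.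
  apply: cube_integral_le => //; first exact: measurable_funTS.
  by move=> x _; rewrite lee_fin; case/andP: (f01 (row_of_tuple x)).
by rewrite intE => fin; rewrite -[RHS]fineK.
Qed.

(** A bound B on the integral along one axis j, uniform in the values of the
    other coordinates, survives integration over these coordinates because their
    cube has measure 1.  Quantifying over the offset a makes the family of
    integrands stable under fixing a coordinate. *)
Lemma cube_integral_slice n (w : R -> R) (C : 'I_n -> R) (j : 'I_n) (B : R) :
  measurable_fun [set: TR] w -> (forall s, 0 <= w s) ->
  (forall a, (\int[mu]_(t in `[0%R, 1%R]) (w (a - (t - C j) ^+ 2))%:E <= B%:E)%E) ->
  forall a, (\int[lebesgue_tuple R n]_(x in tuple_cube R n)
    (w (a - \sum_(i < n) (tnth x i - C i) ^+ 2))%:E <= B%:E)%E.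
Proof.
move=> mw w0.
have mF m (D : 'I_m -> R) a : measurable_fun [set: m.-tuple TR]
    (fun x => (w (a - \sum_(i < m) (tnth x i - D i) ^+ 2))%:E).
  apply/measurable_EFinP; apply: measurableT_comp => //.
  apply: measurable_funB => //; apply: measurable_sum => i.
  by apply: measurable_funX; apply: measurable_funB => //; exact: measurable_tnth.
elim: n C j => [|n ih] C j; first by case: j.
move=> hB a.
have sumE t x : \sum_(i < n.+1) (tnth (cons_pair (t, x)) i - C i) ^+ 2 =
    (t - C ord0) ^+ 2 + \sum_(i < n) (tnth x i - C (lift ord0 i)) ^+ 2.
  rewrite big_ord_recl; congr (_ + _).
  by apply: eq_bigr => i _; rewrite tnthS.
pose F (x : n.+1.-tuple TR) :=
  (w (a - \sum_(i < n.+1) (tnth x i - C i) ^+ 2))%:E.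
have F0 x : (0 <= F x)%E by rewrite lee_fin.
case: (unliftP ord0 j) hB => [k|] -> hB.
  (* When j is not the first coordinate, the first one is frozen and its square
     is absorbed in the offset a. *)
  rewrite (integral_lebesgue_tupleS R n F (mF _ _ _) F0).
  apply: itv_integral_le.
  - exact: (measurable_cube_section R n F (mF _ _ _) F0).
  - by move=> t; apply: integral_ge0.
  move=> t _; rewrite /F; under eq_integral do rewrite sumE opprD addrA.
  exact: (ih _ k).
rewrite (integral_lebesgue_tupleS_swap R n F (mF _ _ _) F0).
apply: cube_integral_le.
- exact: (measurable_cube_section_swap R n F (mF _ _ _) F0).
- by move=> x; apply: integral_ge0.
move=> x _; rewrite /F.
under eq_integral do rewrite sumE opprD [- _ - _]addrC addrA.
exact: hB.
Qed.
End cube_integration.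

(** * The smoothed step function *)

Section smoothed_step.
Variable R : realType.
Local Notation TR := (measurableTypeR R).
Local Notation mu := (@lebesgue_measure R).

Lemma derive1_shift (a : R) : ((fun x : R => x + a : R)^`())%classic = cst 1.
Proof.
by apply/funext => x; rewrite derive1E deriveD// derive_id derive_cst addr0.
Qed.

(** Translate the tail to [0, +oo[ and use (x + a)^2 >= x^2 + a^2. *)
Lemma gauss_tail_le (a : R) : 0 <= a ->
  (\int[mu]_(x in `[a, +oo[) (gauss_fun x)%:E <=
   (gauss_fun a * (Num.sqrt pi / 2))%:E)%E.
Proof.
move=> a0.
have := @increasing_ge0_integration_by_substitutiony R (fun x => x + a) gauss_fun 0.
rewrite derive1_shift add0r => ->.
- rewrite EFinM -integral0y_gauss -ge0_integralZl//=; last 3 first.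
  + by apply/measurable_EFinP/measurable_funTS; exact: measurable_gauss_fun.
  + by move=> x _; rewrite lee_fin gauss_fun_ge0.
  + by rewrite lee_fin gauss_fun_ge0.
  apply: ge0_le_integral => //=.
  + by move=> x _; rewrite lee_fin mulr1 gauss_fun_ge0.
  + apply/measurable_EFinP/measurable_funTS; apply: measurable_funM => //.
    apply: measurableT_comp; first exact: measurable_gauss_fun.
    exact: measurable_funD.
  + apply/measurable_EFinP/measurable_funTS; apply: measurable_funM => //.
    exact: measurable_gauss_fun.
  + move=> x; rewrite in_itv/= andbT => x0.
    rewrite lee_fin mulr1 /gauss_fun -expRD ler_expR.
    by have := mulr_ge0 x0 a0; nra.
- by move=> x y _ _ xy; rewrite ltrD2r.
- by move=> x _; exact: cvg_cst.
- exact: is_cvg_cst.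
- exact: is_cvg_cst.
- split; first by move=> x _; apply: ex_derive.
  by apply: cvg_at_right_filter; apply: cvgD; [exact: cvg_id|exact: cvg_cst].
- exact: cvg_addrr.
- by apply: continuous_subspaceT; exact: continuous_gauss_fun.
- by move=> x _; exact: gauss_fun_ge0.
Qed.

Lemma gauss_integral_tail (a : R) : 0 <= a ->
  0 <= Num.sqrt pi / 2 - \int[mu]_(x in `[0, a]) gauss_fun x
    <= gauss_fun a * (Num.sqrt pi / 2).
Proof.
move=> a0.
have ig : mu.-integrable `[0, +oo[ (EFin \o @gauss_fun R).
  by apply: (integrableS _ _ (subsetT _)) => //; exact: integrableT_gauss.
have -> : Num.sqrt pi / 2 = \int[mu]_(x in `[0, +oo[) gauss_fun x.
  by rewrite /Rintegral integral0y_gauss.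
rewrite Rintegral_itvB//.
rewrite Rintegral_ge0/=; last by move=> x _; exact: gauss_fun_ge0.
have ia : mu.-integrable `[a, +oo[ (EFin \o @gauss_fun R).
  by apply: (integrableS _ _ (subsetT _)) => //; exact: integrableT_gauss.
rewrite Rintegral_itv_obnd_cbnd; last first.
  by apply: (integrableS _ _ (subsetT _)) => //; exact: integrableT_gauss.
rewrite [X in _ <= _ * X]/Rintegral integral0y_gauss/=.
rewrite -lee_fin fineK; last exact: integrable_fin_num.
exact: gauss_tail_le.
Qed.

(** The integral in HK without its factor t; it is even and nonnegative, which
    isolates the oddness of HK - 1/2. *)
Definition dilated_gauss_int (K t : R) : R := \int[mu]_(y in `[0, K]) gauss_fun (t * y).

Lemma continuous_gaussM (t : R) : continuous (fun y : R => gauss_fun (t * y)).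
Proof.
move=> y; apply: (@continuous_comp _ _ _ (fun y : R => t * y) gauss_fun).
  by apply: cvgMl_tmp; exact: cvg_id.
exact: continuous_gauss_fun.
Qed.

Lemma integrable_gaussM (K t : R) :
  mu.-integrable `[0, K] (EFin \o (fun y => gauss_fun (t * y))).
Proof.
apply: continuous_compact_integrable; first exact: segment_compact.
by apply: continuous_subspaceT; exact: continuous_gaussM.
Qed.

Lemma HKE (K t : R) : HK K t = 2^-1 + (Num.sqrt pi)^-1 * (t * dilated_gauss_int K t).
Proof.
rewrite /HK; congr (_ + _ * _).
exact: (RintegralZl _ _ (integrable_gaussM K t)).
Qed.

Lemma HK_opp (K t : R) : HK K (- t) = 1 - HK K t.
Proof.
have avgN : dilated_gauss_int K (- t) = dilated_gauss_int K t.
  by apply: eq_Rintegral => y _; rewrite /gauss_fun mulNr sqrrN.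
by rewrite !HKE avgN; field; rewrite sqrtr_eq0 -ltNge pi_gt0.
Qed.

(** HK is an integral depending on a parameter, so Tonelli gives measurability
    without any study of its variations. *)
Lemma measurable_HK (K : R) : measurable_fun [set: TR] (HK K : TR -> R).
Proof.
pose f (p : TR * TR) := ((gauss_fun (p.1 * p.2) * \1_`[0, K] p.2)%:E : \bar R).
have mf : measurable_fun [set: TR * TR] f.
  apply/measurable_EFinP; apply: measurable_funM.
    apply: (measurableT_comp measurable_gauss_fun).
    by apply: measurable_funM.
  by apply: measurableT_comp => //; exact: measurable_indic.
have f0 p : (0 <= f p)%E by rewrite lee_fin mulr_ge0 ?gauss_fun_ge0.
have := measurable_fun_fubini_tonelli_F (m2 := mu) f mf f0.
rewrite /fubini_F => mF.
have -> : HK K = fun t => 2^-1 + (Num.sqrt pi)^-1 * (t * fine (\int[mu]_y f (t, y))%E).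
  apply/funext => t; rewrite HKE; congr (_ + _ * (_ * _)).
  rewrite /dilated_gauss_int /Rintegral integral_mkcond; congr fine.
  apply: eq_integral => y _; rewrite patchE /f indicE/=.
  by case: ifP => _; rewrite ?mulr1 ?mulr0.
apply: measurable_funD => //; apply: measurable_funM => //.
apply: measurable_funM => //.
exact: measurableT_comp.
Qed.

Lemma HK_pos (K t : R) : 0 < K -> 0 < t ->
  HK K t = 2^-1 + (Num.sqrt pi)^-1 * \int[mu]_(x in `[0, K * t]) gauss_fun x.
Proof.
move=> K0 t0; rewrite HKE; congr (_ + _ * _).
have derM : ((fun y : R => t * y)^`())%classic = cst t.
  by apply/funext => z; rewrite derive1Ml// derive1_id mulr1.
rewrite /dilated_gauss_int -(RintegralZl _ _ (integrable_gaussM K t))//.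
rewrite [RHS]/Rintegral -[in RHS](mulr0 t) [in RHS](mulrC K).
rewrite (@integration_by_substitution_increasing R (fun y => t * y) gauss_fun _ _ (ltW K0)).
- rewrite derM; congr fine; apply: eq_integral => y _ /=.
  by rewrite fctE/= mulrC.
- by move=> x y _ _ xy; rewrite ltr_pM2l.
- by rewrite derM => z _; exact: cvg_cst.
- by rewrite derM; exact: is_cvg_cst.
- by rewrite derM; exact: is_cvg_cst.
- split => //.
  + by apply: cvg_at_right_filter; apply: cvgMl_tmp; exact: cvg_id.
  + by apply: cvg_at_left_filter; apply: cvgMl_tmp; exact: cvg_id.
- by apply: continuous_subspaceT; exact: continuous_gauss_fun.
Qed.

End smoothed_step.

(** * The smoothing error along a line *)

Section line_error.
Variable R : realType.
Local Notation TR := (measurableTypeR R).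
Local Notation mu := (@lebesgue_measure R).

(** 1 - HK K t is the mass of the Gaussian tail beyond K t, divided by
    sqrt pi. *)
Lemma HK_tail (K t : R) : 0 < K -> 0 <= t ->
  0 <= 1 - HK K t <= 2^-1 * gauss_fun (K * t).
Proof.
move=> K0; rewrite le_eqVlt => /predU1P[<-|t0].
  rewrite HKE mulr0 mul0r mulr0 addr0 /gauss_fun expr0n oppr0 expR0.
  lra.
have pi0 : 0 < Num.sqrt pi :> R by rewrite sqrtr_gt0 pi_gt0.
have := gauss_integral_tail R _ (mulr_ge0 (ltW K0) (ltW t0)).
rewrite HK_pos//.
set G := \int[_]_(_ in _) _; set g := gauss_fun _ => /andP[lo hi].
have -> : 1 - (2^-1 + (Num.sqrt pi)^-1 * G) = (Num.sqrt pi)^-1 * (Num.sqrt pi / 2 - G).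
  by field; rewrite gt_eqF.
rewrite mulr_ge0 ?invr_ge0 ?sqrtr_ge0//= ler_pdivrMl//.
by rewrite (le_trans hi)// le_eqVlt; apply/orP; left; apply/eqP; ring.
Qed.

(** Negative t reduce to positive ones by the symmetry HK_opp. *)
Lemma HK_step_error (K t : R) : 0 < K ->
  `| (0 <= t)%R%:R - HK K t | <= 2^-1 * gauss_fun (K * t).
Proof.
move=> K0; have [t0|t0] := leP 0 t.
  by have /andP[lo hi] := HK_tail _ _ K0 t0; rewrite ger0_norm.
have t0' : 0 <= - t by rewrite oppr_ge0 ltW.
have := HK_tail _ _ K0 t0'.
rewrite HK_opp opprB addrC subrK mulrN /gauss_fun sqrrN => /andP[lo hi].
by rewrite sub0r normrN ger0_norm.
Qed.

Lemma HK_01 (K t : R) : 0 < K -> 0 <= HK K t <= 1.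
Proof.
move=> K0.
have pos s : 0 <= s -> 0 <= HK K s <= 1.
  move=> s0; have /andP[lo hi] := HK_tail _ _ K0 s0.
  have := gauss_fun_le1 (K * s); lra.
have [/pos//|t0] := leP 0 t.
have /pos : 0 <= - t by rewrite oppr_ge0 ltW.
rewrite HK_opp; lra.
Qed.

(** Weaker than the Gaussian bound, but with an elementary primitive. *)
Definition lorentz (K s : R) : R := 2^-1 * (oneDsqr (K * s))^-1.

Lemma lorentz_ge0 (K s : R) : 0 <= lorentz K s.
Proof. by rewrite mulr_ge0// invr_ge0 addr_ge0// sqr_ge0. Qed.

Lemma continuous_lorentz (K : R) : continuous (lorentz K).
Proof.
move=> s; apply: cvgMl_tmp.
apply: (@continuous_comp _ _ _ (fun s : R => K * s) (fun x => (oneDsqr x)^-1)).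
  by apply: cvgMl_tmp; exact: cvg_id.
exact: continuous_oneDsqrV.
Qed.

Lemma HK_step_lorentz (K t : R) : 0 < K ->
  `| (0 <= t)%R%:R - HK K t | <= lorentz K t.
Proof.
move=> K0; apply: (le_trans (HK_step_error _ t K0)).
rewrite ler_pM2l// /gauss_fun expRN lef_pV2 ?posrE ?expR_gt0 ?oneDsqr_gt0//.
exact: expR_ge1Dx.
Qed.

Lemma integral_lorentz_shift (l t0 : R) : 0 < l ->
  (\int[mu]_(t in `[0%R, 1%R]) (lorentz l (t - t0))%:E <= (pi / (2 * l))%:E)%E.
Proof.
move=> l0.
pose F (t : R) := (2 * l)^-1 * atan (l * (t - t0)).
have dF (t : R) : is_derive t (1 : R) F (lorentz l (t - t0)).
  rewrite /F; apply: is_derive_eq.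
  rewrite /lorentz /oneDsqr.
  rewrite subr0 /GRing.scale/= mulr1; field.
  by rewrite (gt_eqF l0) andbT gt_eqF// ltr_pwDl// sqr_ge0.
rewrite (@continuous_FTC2 _ _ F).
- rewrite -EFinB lee_fin /F -mulrBr.
  have := atan_ltpi2 (l * (1 - t0)); have := atan_gtNpi2 (l * (0 - t0)).
  rewrite [leLHS]mulrC ler_pM2r ?invr_gt0 ?mulr_gt0//; lra.
- exact: ltr01.
- apply: continuous_subspaceT => t.
  apply: (@continuous_comp _ _ _ (fun t : R => t - t0) (lorentz l)).
    by apply: cvgD; [exact: cvg_id|exact: cvg_cst].
  exact: continuous_lorentz.
- have cF (t : R) : {for t, continuous F}.
    by apply: differentiable_continuous; apply/derivable1_diffP; apply: ex_derive.
  split.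
  + by move=> t _; apply: ex_derive.
  + by apply: cvg_at_right_filter; exact: cF.
  + by apply: cvg_at_left_filter; exact: cF.
- by move=> t _; rewrite derive1E; apply: derive_val.
Qed.

(** t0 is the zero of a - (t - c)^2 to the right of c when it is nonnegative, and
    otherwise the end 0 of the half-line, where the absolute value is least. *)
Lemma parabola_linear_growth (c v a : R) : 0 < v -> c <= - v ->
  exists t0, forall t, 0 <= t -> 2 * v * `|t - t0| <= `|a - (t - c) ^+ 2|.
Proof.
move=> v0 cv.
have [h|h] := leP (- c) (Num.sqrt a).
  have a0 : 0 <= a.
    by rewrite leNgt; apply/negP => a0; move: h; rewrite ltr0_sqrtr//; lra.
  exists (c + Num.sqrt a) => t t0.
  have -> : a - (t - c) ^+ 2 = (t - (c + Num.sqrt a)) * - (t - c + Num.sqrt a).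
    by rewrite -{1}(sqr_sqrtr a0); ring.
  rewrite normrM mulrC ler_wpM2l// normrN ger0_norm; lra.
exists 0 => t t0; rewrite subr0 ger0_norm// distrC.
have ac : a <= c ^+ 2.
  have [a0|a0] := leP 0 a; last by rewrite (le_trans (ltW a0))// sqr_ge0.
  rewrite -(sqr_sqrtr a0) -(sqrrN c) ler_pXn2r ?nnegrE ?sqrtr_ge0//; lra.
apply: le_trans (ler_norm _).
have := mulr_ge0 t0 t0; nra.
Qed.

Lemma integral_lorentz_line (K v a c : R) : 0 < K -> 0 < v ->
  (forall t, 0 <= t <= 1 -> v <= `|t - c|) ->
  (\int[mu]_(t in `[0%R, 1%R]) (lorentz K (a - (t - c) ^+ 2))%:E
    <= (pi / (4 * K * v))%:E)%E.
Proof.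
move=> K0 v0 hv.
have [t0 h] : exists t0, forall t, 0 <= t <= 1 ->
    2 * v * `|t - t0| <= `|a - (t - c) ^+ 2|.
  have [c0|c0] := leP c 0.
    have cv : c <= - v.
      by have := hv 0; rewrite lexx ler01 sub0r normrN ler0_norm// => /(_ isT); lra.
    have [t0 h] := parabola_linear_growth c v a v0 cv.
    by exists t0 => t /andP[t_ge0 _]; exact: h.
  have c1 : 1 < c.
    rewrite ltNge; apply/negP => c1; have := hv c.
    by rewrite (ltW c0) c1 subrr normr0 => /(_ isT); rewrite leNgt v0.
  have cv : 1 - c <= - v.
    have := hv 1; rewrite lexx ler01 ltr0_norm ?subr_lt0// => /(_ isT); lra.
  (* Here c lies to the right of the interval: reflect t to 1 - t. *)
  have [t0 h] := parabola_linear_growth (1 - c) v a v0 cv.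
  exists (1 - t0) => t /andP[_ t1].
  have := h (1 - t); rewrite subr_ge0 => /(_ t1).
  rewrite -[`|1 - t - t0|]normrN (_ : - (1 - t - t0) = t - (1 - t0)); last by ring.
  by rewrite (_ : 1 - t - (1 - c) = - (t - c)) ?sqrrN//; ring.
apply: (@le_trans _ _ (\int[mu]_(t in `[0%R, 1%R])
    (lorentz (2 * K * v) (t - t0))%:E)%E); last first.
  apply: (le_trans (integral_lorentz_shift _ t0 _)).
    by rewrite !mulr_gt0.
  by rewrite lee_fin (_ : 2 * (2 * K * v) = 4 * K * v)//; ring.
apply: ge0_le_integral => //=.
- by move=> t _; rewrite lee_fin lorentz_ge0.
- apply/measurable_EFinP/measurable_funTS.
  apply: (measurableT_comp (f := lorentz K)).
    by apply: continuous_measurable_fun; exact: continuous_lorentz.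
  by apply: measurable_funB => //; apply: measurable_funX; apply: measurable_funB.
- apply/measurable_EFinP/measurable_funTS.
  apply: (measurableT_comp (f := lorentz (2 * K * v))).
    by apply: continuous_measurable_fun; exact: continuous_lorentz.
  by apply: measurable_funB.
move=> t; rewrite in_itv/= => /h ht.
rewrite lee_fin ler_pM2l// lef_pV2 ?posrE ?oneDsqr_gt0// /oneDsqr lerD2l.
rewrite -(real_normK (num_real (K * _))) -(real_normK (num_real (_ * (t - t0)))).
rewrite ler_pXn2r ?nnegrE// !normrM (gtr0_norm K0) (gtr0_norm v0) gtr0_norm//.
have := ler_wpM2l (ltW K0) ht.
by rewrite (_ : K * (2 * v * _) = 2 * K * v * `|t - t0|)//; ring.
Qed.

End line_error.

(** * The error estimate *)

Section error_estimate.
Variable R : realType.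
Local Notation TR := (measurableTypeR R).

Lemma cube_integrable n (f : n.-tuple TR -> R) :
  measurable_fun [set: n.-tuple TR] f -> (forall x, 0 <= f x <= 1) ->
  (lebesgue_tuple R n).-integrable (tuple_cube R n) (EFin \o f).
Proof.
move=> mf f01; apply: measurable_bounded_integrable.
- exact: measurable_tuple_cube.
- by rewrite [X in (X < _)%E](lebesgue_tuple_cube R n) ltry.
- exact: measurable_funTS.
- exists 1; split => // M M1 x _ /=.
  by have /andP[f0 f1] := f01 x; rewrite ger0_norm// (le_trans f1)// ltW.
Qed.

Lemma cube_integral_dist n (f g h k : n.-tuple TR -> R) :
  measurable_fun [set: n.-tuple TR] f -> (forall x, 0 <= f x <= 1) ->
  measurable_fun [set: n.-tuple TR] g -> (forall x, 0 <= g x <= 1) ->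
  measurable_fun [set: n.-tuple TR] h -> (forall x, 0 <= h x) ->
  measurable_fun [set: n.-tuple TR] k -> (forall x, 0 <= k x) ->
  (forall x, `|f x - g x| <= h x + k x) ->
  (`| \int[lebesgue_tuple R n]_(x in tuple_cube R n) (f x)%:E -
      \int[lebesgue_tuple R n]_(x in tuple_cube R n) (g x)%:E | <=
   \int[lebesgue_tuple R n]_(x in tuple_cube R n) (h x)%:E +
   \int[lebesgue_tuple R n]_(x in tuple_cube R n) (k x)%:E)%E.
Proof.
move=> mf f01 mg g01 mh h0 mk k0 fg.
have mC := measurable_tuple_cube R n.
rewrite -integralB_EFin//; [|exact: cube_integrable|exact: cube_integrable].
rewrite -ge0_integralD//; last 4 first.
- by move=> x _; rewrite lee_fin.
- exact/measurable_EFinP/measurable_funTS.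
- by move=> x _; rewrite lee_fin.
- exact/measurable_EFinP/measurable_funTS.
apply: (le_trans (le_abse_integral _ _ _)) => //.
  by apply/measurable_EFinP/measurable_funTS; exact: measurable_funB.
apply: ge0_le_integral => //=.
- apply/measurable_EFinP/measurable_funTS; apply: measurableT_comp => //.
  exact: measurable_funB.
- by apply/measurable_EFinP/measurable_funTS; exact: measurable_funD.
- by move=> x _; rewrite lee_fin.
Qed.

(** Let p be the point of the cube nearest to c.  The squares of the coordinates
    of p - c sum to at least 1, so one of them is at least 1/n, and
    |p_j - c_j| is the distance from c_j to the interval [0, 1]. *)
Lemma far_coordinate n (c : 'rV[R]_n) : (0 < n)%N ->
  (forall x, unit_cube n x -> 1 <= enorm (x - c)) ->
  exists j, forall t : R, 0 <= t <= 1 -> (Num.sqrt n%:R)^-1 <= `|t - c 0 j|.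
Proof.
move=> n0 hc.
pose p : 'rV[R]_n := \row_i Num.min 1 (Num.max 0 (c 0 i)).
have pc i : p 0 i = Num.min 1 (Num.max 0 (c 0 i)) by rewrite mxE.
have p01 : unit_cube n p.
  by move=> i; rewrite pc le_min ler01 le_max lexx/= ge_min lexx.
have pn i (t : R) : 0 <= t <= 1 -> `|p 0 i - c 0 i| <= `|t - c 0 i|.
  move=> /andP[t0 t1]; rewrite pc.
  have [c0|c0] := leP 0 (c 0 i); last first.
    rewrite min_r// !ger0_norm; lra.
  have [c1|c1] := leP 1 (c 0 i); last by rewrite subrr normr0.
  rewrite !ler0_norm; lra.
have s0 : 0 < Num.sqrt n%:R :> R by rewrite sqrtr_gt0 ltr0n.
have [j hj] : exists j, (Num.sqrt n%:R)^-1 <= `|p 0 j - c 0 j|.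
  apply: contrapT => /forallNP far.
  have := hc p p01; rewrite leNgt => /negP; apply.
  rewrite /enorm -sqrtr1 ltr_sqrt//.
  have -> : 1 = \sum_(i < n) (n%:R^-1 : R).
    by rewrite sumr_const card_ord -[_ *+ _]mulr_natl divff// pnatr_eq0 -lt0n.
  apply: ltr_sum => [|i _].
    apply/hasP; exists (Ordinal n0) => //; exact: mem_index_enum.
  have /negP := far i; rewrite -ltNge !mxE => h.
  rewrite -(real_normK (num_real _)) -[X in _ < X^-1](@sqr_sqrtr _ n%:R)// -exprVn.
  by rewrite ltr_pXn2r// nnegrE.
by exists j => t /(pn j); exact: le_trans.
Qed.

Lemma rho_row_of_tuple n (c : 'rV[R]_n) (r : R) (x : n.-tuple TR) :
  rho c r (row_of_tuple x) = r ^+ 2 - \sum_(i < n) (tnth x i - c 0 i) ^+ 2.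
Proof.
rewrite /rho /enorm sqr_sqrtr; last by apply: sumr_ge0 => i _; exact: sqr_ge0.
by congr (_ - _); apply: eq_bigr => i _; rewrite !mxE.
Qed.

Lemma measurable_rho n (c : 'rV[R]_n) (r : R) :
  measurable_fun [set: n.-tuple TR] (fun x => rho c r (row_of_tuple x)).
Proof.
under eq_fun do rewrite rho_row_of_tuple.
apply: measurable_funB => //; apply: measurable_sum => i.
by apply: measurable_funX; apply: measurable_funB => //; exact: measurable_tnth.
Qed.

Lemma closed_eballE n (c : 'rV[R]_n) (r : R) (x : 'rV[R]_n) : 0 < r ->
  closed_eball c r x <-> 0 <= rho c r x.
Proof.
move=> r0; rewrite /closed_eball /rho /= subr_ge0 ler_pXn2r ?nnegrE ?sqrtr_ge0//.
exact: ltW.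
Qed.

(** The line integral along the far coordinate is pi/(4Kv) with v = 1/sqrt n, and
    pi <= 4. *)
Lemma cube_integral_lorentz_rho n (c : 'rV[R]_n) (r K : R) : (0 < n)%N ->
  (forall x, unit_cube n x -> 1 <= enorm (x - c)) -> 0 < K ->
  (\int[lebesgue_tuple R n]_(x in tuple_cube R n)
    (lorentz R K (rho c r (row_of_tuple x)))%:E <= (Num.sqrt n%:R / K)%:E)%E.
Proof.
move=> n0 hc K0; have [j hj] := far_coordinate n c n0 hc.
have s0 : 0 < Num.sqrt n%:R :> R by rewrite sqrtr_gt0 ltr0n.
under eq_integral do rewrite rho_row_of_tuple.
apply: (cube_integral_slice R n (lorentz R K) (fun i => c 0 i) j).
- by apply: continuous_measurable_fun; exact: continuous_lorentz.
- exact: lorentz_ge0.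
move=> a; apply: le_trans (integral_lorentz_line _ _ _ a _ K0 _ hj) _.
  by rewrite invr_gt0.
rewrite lee_fin.
have -> : pi / (4 * K * (Num.sqrt n%:R)^-1) = pi / 4 * (Num.sqrt n%:R / K).
  by field; rewrite !gt_eqF.
rewrite ler_piMl ?divr_ge0 ?(ltW K0) ?(ltW s0)//.
by have := @pihalf_lt2 R; lra.
Qed.

Lemma vol_lens n (C : 'I_2 -> 'rV[R]_n) (r : 'I_2 -> R) :
  (forall i, 0 < r i) ->
  vol (lens C r) = (\int[lebesgue_tuple R n]_(x in tuple_cube R n)
    ((0 <= rho (C 0) (r 0) (row_of_tuple x))%R%:R *
     (0 <= rho (C 1) (r 1) (row_of_tuple x))%R%:R)%:E)%E.
Proof.
move=> hr.
pose B i := [set x : n.-tuple TR | 0 <= rho (C i) (r i) (row_of_tuple x)].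
have mB i : measurable (B i).
  have -> : B i = (fun x => rho (C i) (r i) (row_of_tuple x)) @^-1` `[0, +oo[.
    by apply/seteqP; split => x; rewrite /B/= in_itv/= andbT.
  by rewrite -[X in measurable X]setTI; exact: measurable_rho.
have mC := measurable_tuple_cube R n.
transitivity (\int[lebesgue_tuple R n]_(x in tuple_cube R n)
    (\1_(B 0 `&` B 1) x)%:E)%E.
  rewrite integral_indic//; last exact: measurableI.
  congr (lebesgue_tuple R n _); apply/seteqP; split => x.
    by move=> [[cx] /(closed_eballE _ _ _ _ (hr 0)) b0 /(closed_eballE _ _ _ _ (hr 1))].
  by move=> [[/(closed_eballE _ _ _ _ (hr 0)) b0 /(closed_eballE _ _ _ _ (hr 1))] b1].
apply: eq_integral => x _; rewrite indicE in_setI -natrM mulnb.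
by rewrite !mem_setE.
Qed.

Lemma measurable_step : measurable_fun [set: TR] (fun t : TR => (0 <= t)%R%:R : TR).
Proof.
rewrite (_ : (fun t : R => _) = \1_(`[0, +oo[ : set TR)); first exact: measurable_indic.
by apply/funext => t; rewrite indicE mem_setE in_itv/= andbT.
Qed.

Lemma prod_dist_le (a b p q : R) : 0 <= p <= 1 -> 0 <= b <= 1 ->
  `|a * b - p * q| <= `|a - p| + `|b - q|.
Proof.
move=> /andP[p0 p1] /andP[b0 b1].
rewrite (_ : a * b - p * q = (a - p) * b + p * (b - q)); last by ring.
rewrite (le_trans (ler_normD _ _))// !normrM (ger0_norm p0) (ger0_norm b0).
by rewrite lerD// ?ler_piMr ?ler_piMl.
Qed.

Lemma le_sqrt_bound (n : nat) (K d : R) : (1 <= n)%N -> 0 < K -> 1 <= d ->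
  Num.sqrt n%:R / K <= n%:R / (Num.sqrt (2 * n%:R - 1) * K) *
    (Num.sqrt n%:R * (Num.sqrt n%:R / 2 + d)).
Proof.
move=> n1 K0 d1.
have n1' : 1 <= n%:R :> R by rewrite ler1n.
have s0 : 0 <= Num.sqrt n%:R :> R by rewrite sqrtr_ge0.
have q0 : 0 < Num.sqrt (2 * n%:R - 1) :> R by rewrite sqrtr_gt0; lra.
have qn : 1 <= n%:R / Num.sqrt (2 * n%:R - 1) :> R.
  (* n ^+ 2 - (2 * n - 1) is the square of n - 1. *)
  rewrite ler_pdivlMr// mul1r -[leRHS]ger0_norm ?ler0n// -sqrtr_sqr ler_sqrt ?sqr_ge0//.
  nra.
have -> : n%:R / (Num.sqrt (2 * n%:R - 1) * K) * (Num.sqrt n%:R * (Num.sqrt n%:R / 2 + d)) =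
   Num.sqrt n%:R / K * (n%:R / Num.sqrt (2 * n%:R - 1) * (Num.sqrt n%:R / 2 + d)).
  by field; rewrite !gt_eqF.
rewrite ler_peMr ?divr_ge0 ?(ltW K0)//.
by apply: mulr_ege1 => //; rewrite ler_wpDl// divr_ge0.
Qed.

End error_estimate.

Theorem corollary1 (R : realType) (n : nat) (hn : (1 <= n)%N)
    (C : 'I_2 -> 'rV[R]_n) (r : 'I_2 -> R) (hr : forall i, 0 < r i)
    (hC : forall i (x : 'rV[R]_n), unit_cube n x -> 1 <= enorm (x - C i)) :
  forall K : R, 0 < K ->
    (`| vol (lens C r) - (TK C r K)%:E | <=
      (n%:R / (Num.sqrt (2 * n%:R - 1) * K) *
        \sum_(i < 2) Num.sqrt n%:R *
          (Num.sqrt n%:R / 2 + enorm (C i - 2^-1 *: const_mx 1)))%:E)%E.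
Proof.
move=> K K0.
pose S i (x : n.-tuple (measurableTypeR R)) : R := (0 <= rho (C i) (r i) (row_of_tuple x))%R%:R.
pose H i (x : n.-tuple (measurableTypeR R)) : R := HK K (rho (C i) (r i) (row_of_tuple x)).
pose L i (x : n.-tuple (measurableTypeR R)) : R := lorentz R K (rho (C i) (r i) (row_of_tuple x)).
have mS i : measurable_fun [set: n.-tuple (measurableTypeR R)] (S i).
  exact: (measurableT_comp (measurable_step R) (measurable_rho R n (C i) (r i))).
have mH i : measurable_fun [set: n.-tuple (measurableTypeR R)] (H i).
  exact: (measurableT_comp (measurable_HK R K) (measurable_rho R n (C i) (r i))).
have mL i : measurable_fun [set: n.-tuple (measurableTypeR R)] (L i).
  apply: (measurableT_comp (f := lorentz R K)); last exact: measurable_rho.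
  by apply: continuous_measurable_fun; exact: continuous_lorentz.
have S01 i x : 0 <= S i x <= 1 by rewrite /S ler0n lern1 leq_b1.
have H01 i x : 0 <= H i x <= 1 by exact: HK_01.
have prod01 (a b : R) : 0 <= a <= 1 -> 0 <= b <= 1 -> 0 <= a * b <= 1.
  by move=> /andP[a0 a1] /andP[b0 b1]; rewrite mulr_ge0// mulr_ile1.
rewrite vol_lens// /TK iterated_intE; last 2 first.
- exact: (measurable_funM (mH 0) (mH 1)).
- by move=> x; apply: prod01; exact: HK_01.
apply: (le_trans (cube_integral_dist R n (fun x => S 0 x * S 1 x)
  (fun x => H 0 x * H 1 x) (L 0) (L 1) _ _ _ _ _ _ _ _ _)) => //.
- exact: measurable_funM.
- by move=> x; exact: prod01.
- exact: measurable_funM.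
- by move=> x; exact: prod01.
- by move=> x; exact: lorentz_ge0.
- by move=> x; exact: lorentz_ge0.
- move=> x; apply: (le_trans (prod_dist_le R _ _ _ _ (H01 0 x) (S01 1 x))).
  by apply: lerD; exact: HK_step_lorentz.
(* The hypothesis at the center of the cube. *)
have d1 i : 1 <= enorm (C i - 2^-1 *: const_mx 1).
  rewrite [X in 1 <= X](_ : _ = enorm (2^-1 *: const_mx 1 - C i)).
    apply: hC => k; rewrite !mxE; lra.
  rewrite /enorm; congr (Num.sqrt _); apply: eq_bigr => k _.
  by rewrite !mxE -sqrrN opprB.
rewrite big_ord_recl big_ord1 mulrDr EFinD.
have -> : lift ord0 ord0 = 1 :> 'I_2 by exact: val_inj.
by apply: leeD; (apply: le_trans (cube_integral_lorentz_rho R _ _ _ _ _ (hC _) K0) _ => //;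
  rewrite lee_fin; exact: le_sqrt_bound).
Qed.
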